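(* Consider a solution candidate of positive elliptic-elliptic form, i.e. functions $w_i=r_i(t)\cos[\alpha(t)+a_i]$, $x_i=r_i(t)\sin[\alpha(t)+a_i]$, $y_i=\rho_i(t)\cos[\beta(t)+b_i]$, $z_i=\rho_i(t)\sin[\beta(t)+b_i]$, $i=1,\dots,N$, with $a_i,b_i$ constants, $\alpha,\beta$ nonconstant, $0\le r_i,\rho_i\le1$ and $r_i^2+\rho_i^2=1$. It is a positive elliptic-elliptic rotopulsator of the curved $N$-body problem in $\mathbb S^3$ if and only if $$\dot\alpha=\frac{c_1}{\sum_{k=1}^Nm_kr_k^2},\qquad \dot\beta=\frac{c_2}{M-\sum_{k=1}^Nm_kr_k^2},$$ with $c_1,c_2$, $M=\sum_{k=1}^Nm_k$ nonzero constants, there are at least two distinct indices $i,j$ such that $q_{ij}$ is not constant, and the variables $r_1,\dots,r_N$ satisfy the first-order system of $4N$ equations $$\begin{cases}\dot r_i=s_i\\ \dot s_i=G_i(\mathbf r,s_i)\\ r_i\ddot\alpha+2\dot r_i\dot\alpha=\sum_{j\ne i}\frac{m_jr_j\sin(a_j-a_i)}{(1-q_{ij}^2)^{3/2}}\\ \rho_i\ddot\beta+2\dot\rho_i\dot\beta=\sum_{j\ne i}\frac{m_j\rho_j\sin(b_j-b_i)}{(1-q_{ij}^2)^{3/2}},\end{cases}$$ $i=1,\dots,N$, where $r_i^2+\rho_i^2=1$, $\mathbf r=(r_1,\dots,r_N)$, $$G_i(\mathbf r,s_i)=r_i(1-r_i^2)\bigg[\frac{c_1^2}{(\sum_{k}m_kr_k^2)^2}-\frac{c_2^2}{(M-\sum_{k}m_kr_k^2)^2}\bigg]-\frac{r_is_i^2}{1-r_i^2}+\sum_{j\ne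 i}\frac{m_j[r_j(1-r_i^2)\cos(a_i-a_j)-r_i(1-r_i^2)^{1/2}(1-r_j^2)^{1/2}\cos(b_i-b_j)]}{(1-q_{ij}^2)^{3/2}},$$ and for any $i\neq j$, $q_{ij}=r_ir_j\cos(a_i-a_j)+(1-r_i^2)^{1/2}(1-r_j^2)^{1/2}\cos(b_i-b_j)$. If (the other conditions holding) the $q_{ij}$ are constant for all distinct $i,j$, then the solution is a positive elliptic-elliptic relative equilibrium. If $q_{ij}=\pm1$ for some distinct $i,j$, then such solutions do not exist.
   Context: Masses $m_1,\dots,m_N>0$, $N\ge 2$; dots denote $d/dt$; $\sum_{j\ne i}$ runs over $j\in\{1,\dots,N\}\setminus\{i\}$. $\mathbb S^3=\{(w,x,y,z)\in\mathbb R^4: w^2+x^2+y^2+z^2=1\}$, $\cdot$ is the standard inner product, $\mathbf q_i=(w_i,x_i,y_i,z_i)$, $q_{ij}:=\mathbf q_i\cdot\mathbf q_j$, $\dot q_{ii}:=\dot{\mathbf q}_i\cdot\dot{\mathbf q}_i$. The curved $N$-body problem in $\mathbb S^3$ is the system $$\ddot{\mathbf q}_i=\sum_{j\ne i}\frac{m_j(\mathbf q_j-q_{ij}\mathbf q_i)}{(1-q_{ij}^2)^{3/2}}-\dot q_{ii}\mathbf q_i,\quad q_{ii}=1,\quad i=1,\dots,N.$$ A positive elliptic-elliptic rotopulsator is a solution of this system of the positive elliptic-elliptic form described in the claim for which there are at least two indices $i\ne j$ with $q_{ij}$ not constant; if instead all $q_{ij}$, $i\neq j$, are constant, the solution is called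 a positive elliptic-elliptic relative equilibrium.
   Formalization: For the ''if'' direction and the relative-equilibrium claim it is assumed that no r_i is identically 1 on a time subinterval, since G_i has denominator 1-r_i^2 and is undefined there; at times with r_i=1 the quotient in G_i is read as 0. *)

(* Defs.v *)
From HB Require Import structures.
From mathcomp Require Import all_boot all_order all_algebra.
From mathcomp Require Import all_classical all_reals all_analysis.

Set Implicit Arguments.
Unset Strict Implicit.
Unset Printing Implicit Defensive.

Import Order.TTheory GRing.Theory Num.Theory.
Import numFieldNormedType.Exports.

Local Open Scope classical_set_scope.
Local Open Scope ring_scope.

(* Time ranges over an open interval J; functions of time are total functions
   on R of which only the values on J matter. *)

Definition constant_over (R : realType) (J : set R) (f : R -> R) : Prop :=
  forall t u, J t -> J u -> f t = f u.

Definition C2_on (R : realType) (J : set R) (f : R -> R) : Prop :=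
  forall t, J t ->
    [/\ derivable f t 1, derivable (derive1 f) t 1
      & {for t, continuous (derive1n 2 f)}].

Definition dot (R : realType) (u v : 'rV[R]_4) : R := \sum_k u 0 k * v 0 k.

Definition curved_force (R : realType) (N : nat) (m : 'I_N -> R)
    (q : 'I_N -> 'rV[R]_4) (i : 'I_N) : 'rV[R]_4 :=
  \sum_(j < N | j != i)
    (m j / (1 - dot (q i) (q j) ^+ 2) `^ (3 / 2)) *:
      (q j - dot (q i) (q j) *: q i).

(* The vector field is undefined when some q_ij = 1 or -1.  Division is total
   here, so that these configurations have to be excluded explicitly. *)
Definition solution (R : realType) (N : nat) (J : set R) (m : 'I_N -> R)
    (q : 'I_N -> R -> 'rV[R]_4) : Prop :=
  forall t, J t ->
    (forall i j, i != j -> dot (q i t) (q j t) ^+ 2 != 1) /\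
    (forall i,
      [/\ derivable (q i) t 1,
          derivable (derive1 (q i)) t 1,
          dot (q i t) (q i t) = 1
        & derive1n 2 (q i) t = curved_force m (fun j => q j t) i
            - dot (derive1 (q i) t) (derive1 (q i) t) *: q i t]).

Definition elliptic_elliptic_form (R : realType) (N : nat) (J : set R)
    (q : 'I_N -> R -> 'rV[R]_4) (a b : 'I_N -> R) (alpha beta : R -> R)
    (r rho : 'I_N -> R -> R) : Prop :=
  [/\ [/\ C2_on J alpha, C2_on J beta,
          forall i, C2_on J (r i) & forall i, C2_on J (rho i)],
      ~ constant_over J alpha, ~ constant_over J beta,
      forall i t, J t ->
        [/\ 0 <= r i t <= 1, 0 <= rho i t <= 1
          & r i t ^+ 2 + rho i t ^+ 2 = 1]
    & forall i t, J t ->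
        q i t = \row_(k < 4) [:: r i t * cos (alpha t + a i);
                                 r i t * sin (alpha t + a i);
                                 rho i t * cos (beta t + b i);
                                 rho i t * sin (beta t + b i)]`_k].

Definition positive_elliptic_elliptic (R : realType) (N : nat) (J : set R)
    (q : 'I_N -> R -> 'rV[R]_4) : Prop :=
  exists a b alpha beta r rho,
    elliptic_elliptic_form J q a b alpha beta r rho.

Definition rotopulsator (R : realType) (N : nat) (J : set R) (m : 'I_N -> R)
    (q : 'I_N -> R -> 'rV[R]_4) : Prop :=
  [/\ solution J m q, positive_elliptic_elliptic J q
    & exists i j, i != j /\
        ~ constant_over J (fun t => dot (q i t) (q j t))].

Definition relative_equilibrium (R : realType) (N : nat) (J : set R)
    (m : 'I_N -> R) (q : 'I_N -> R -> 'rV[R]_4) : Prop :=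
  [/\ solution J m q, positive_elliptic_elliptic J q
    & forall i j, i != j -> constant_over J (fun t => dot (q i t) (q j t))].

Definition total_mass (R : realType) (N : nat) (m : 'I_N -> R) : R :=
  \sum_(k < N) m k.

Definition inertia (R : realType) (N : nat) (m r : 'I_N -> R) : R :=
  \sum_(k < N) m k * r k ^+ 2.

(* q_ij as a function of (r_1, ..., r_N). *)
Definition qr (R : realType) (N : nat) (a b r : 'I_N -> R) (i j : 'I_N) : R :=
  r i * r j * cos (a i - a j)
  + Num.sqrt (1 - r i ^+ 2) * Num.sqrt (1 - r j ^+ 2) * cos (b i - b j).

(* At r i = 1 the quotient below is 0 / 0 or s ^+ 2 / 0; it evaluates to 0,
   since division by 0 returns 0. *)
Definition G (R : realType) (N : nat) (m a b : 'I_N -> R) (c1 c2 : R)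
    (i : 'I_N) (r : 'I_N -> R) (s : R) : R :=
  r i * (1 - r i ^+ 2) *
    (c1 ^+ 2 / inertia m r ^+ 2
     - c2 ^+ 2 / (total_mass m - inertia m r) ^+ 2)
  - r i * s ^+ 2 / (1 - r i ^+ 2)
  + \sum_(j < N | j != i)
      m j * (r j * (1 - r i ^+ 2) * cos (a i - a j)
             - r i * Num.sqrt (1 - r i ^+ 2) * Num.sqrt (1 - r j ^+ 2)
               * cos (b i - b j))
      / (1 - qr a b r i j ^+ 2) `^ (3 / 2).

Definition angular_velocities (R : realType) (N : nat) (J : set R)
    (m : 'I_N -> R) (c1 c2 : R) (alpha beta : R -> R) (r : 'I_N -> R -> R) :
    Prop :=
  forall t, J t ->
    let I := inertia m (r^~ t) in
    [/\ I != 0, total_mass m - I != 0,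
        derive1 alpha t = c1 / I & derive1 beta t = c2 / (total_mass m - I)].

(* As in [solution], the system is only meaningful when no q_ij is 1 or -1. *)
Definition first_order_system (R : realType) (N : nat) (J : set R)
    (m a b : 'I_N -> R) (c1 c2 : R) (alpha beta : R -> R)
    (r rho : 'I_N -> R -> R) : Prop :=
  exists s : 'I_N -> R -> R, forall t, J t ->
    let Q := qr a b (r^~ t) in
    (forall i j, i != j -> Q i j ^+ 2 != 1) /\
    (forall i,
      [/\ is_derive t 1 (r i) (s i t),
          is_derive t 1 (s i) (G m a b c1 c2 i (r^~ t) (s i t)),
          r i t * derive1n 2 alpha t + 2 * derive1 (r i) t * derive1 alpha t
            = \sum_(j < N | j != i)
                m j * r j t * sin (a j - a i) / (1 - Q i j ^+ 2) `^ (3 / 2)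
        & rho i t * derive1n 2 beta t + 2 * derive1 (rho i) t * derive1 beta t
            = \sum_(j < N | j != i)
                m j * rho j t * sin (b j - b i) / (1 - Q i j ^+ 2) `^ (3 / 2)]).

Definition pulsation_equations (R : realType) (N : nat) (J : set R)
    (m a b : 'I_N -> R) (alpha beta : R -> R) (r rho : 'I_N -> R -> R) :
    Prop :=
  exists c1 c2 : R,
    [/\ [/\ c1 != 0, c2 != 0 & total_mass m != 0],
        angular_velocities J m c1 c2 alpha beta r
      & first_order_system J m a b c1 c2 alpha beta r rho].

(* No r_i is identically 1 on a subinterval of J: the functions G_i, which have
   the denominator 1 - r_i ^+ 2, are defined on a dense set of times.  On an
   interval with r_i = 1 the equation for s_i is void and the force on the i-th
   body in the directions y and z is not controlled by the system.  For example,
   for N = 2, take a = b = 0, r_1 = 1, a constant 0 < r_2 < 1, constant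
   angular velocities and c2 such that G_2 = 0: the equations of the system
   hold (with 0 / 0 = 0), but the first body is not in equilibrium. *)
Definition G_densely_defined (R : realType) (N : nat) (J : set R)
    (r : 'I_N -> R -> R) : Prop :=
  forall i, J `<=` closure [set t | J t /\ r i t < 1].

(* Main.v *)
Require Import Defs.
From HB Require Import structures.
From mathcomp Require Import all_boot all_order all_algebra.
From mathcomp Require Import all_classical all_reals all_analysis.
From mathcomp Require Import ring lra.

Import Order.TTheory GRing.Theory Num.Theory.
Import numFieldNormedType.Exports.

Local Open Scope classical_set_scope.
Local Open Scope ring_scope.

Set Implicit Arguments.
Unset Strict Implicit.
Unset Printing Implicit Defensive.

(* In the frame that rotates with the angles [alpha + a i] and [beta + b i], the
   equation of motion of the [i]-th body splits into a radial and a tangential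
   equation in each of the two planes.  The tangential equations are the last two
   of the system.  Summed with weights [m i * r i] their right-hand sides cancel
   by antisymmetry, so the momenta [I * alpha'] and [(M - I) * beta'] are
   constant.  The moments of inertia never vanish: the radial equations are
   linear in [r], so if all [r i] vanish at one time they vanish identically, and
   then all [q_ij] are constant.  The constraint [r i ^+ 2 + rho i ^+ 2 = 1]
   turns the radial equation for [r i] into [r i'' = G_i], also where [r i = 1],
   and makes the radial equation for [rho i] redundant where [r i < 1]. *)

(** * Calculus on an interval *)

Lemma is_derive_continuous (R : realType) (f : R -> R) (t d : R) :
  is_derive t 1 f d -> {for t, continuous f}.
Proof.
by move=> [df _]; apply/differentiable_continuous/derivable1_diffP.
Qed.

Lemma is_derive1P (R : realType) (V : normedModType R) (f : R -> V) (t : R) :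
  derivable f t 1 -> is_derive t 1 f (derive1 f t).
Proof. by move=> df; rewrite derive1E; exact: derivableP. Qed.

Lemma interval_segment (R : realType) (J : set R) (t u x : R) :
  is_interval J -> J t -> J u -> x \in `[t, u] -> J x.
Proof. by move=> hJ Jt Ju; rewrite in_itv => /hJ; exact. Qed.

Lemma segment_within_continuous (R : realType) (J : set R) (f : R -> R)
    (t u : R) :
  is_interval J -> J t -> J u -> (forall x, J x -> {for x, continuous f}) ->
  {within `[t, u], continuous f}.
Proof.
move=> hJ Jt Ju cf; apply: continuous_in_subspaceT => x.
by rewrite inE => /= /(interval_segment hJ Jt Ju) /cf.
Qed.

Lemma derive0_constant_over (R : realType) (J : set R) (f : R -> R) :
  is_interval J -> (forall t, J t -> is_derive t 1 f 0) -> constant_over J f.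
Proof.
move=> hJ df.
have cf x : J x -> {for x, continuous f} by move/df/is_derive_continuous.
suff H t u : t <= u -> J t -> J u -> f t = f u.
  by move=> t u Jt Ju; case: (leP t u) => [/H|/ltW/H/(_ Ju Jt)]; [exact|].
move=> tu Jt Ju; have [x x_tu|c _] := @MVT_segment _ f (fun=> 0) _ _ tu _
    (segment_within_continuous hJ Jt Ju cf).
  by apply/df/(interval_segment hJ Jt Ju); exact: subset_itv_oo_cc.
by rewrite mul0r => /eqP; rewrite subr_eq0 => /eqP.
Qed.

(** Let [k] be the maximum of [K] on the segment between [t0] and [t]. After [t0] the function
    [E * exp (- k t)] is nonincreasing, and before [t0] the function [E * exp (k t)] is
    nondecreasing. Both vanish at [t0], so [E] is at most 0 on either side. *)
Lemma gronwall_eq0 (R : realType) (J : set R) (E dE K : R -> R) (t0 : R) :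
  is_interval J -> J t0 -> E t0 = 0 ->
  (forall t, J t -> is_derive t 1 E (dE t)) ->
  (forall t, J t -> {for t, continuous K}) ->
  (forall t, J t -> 0 <= E t) ->
  (forall t, J t -> `|dE t| <= K t * E t) ->
  forall t, J t -> E t = 0.
Proof.
move=> hJ J0 E0 dEE cK Ege0 dEK.
pose F (c t : R) := E t * expR (c * t).
have dF c t : J t -> is_derive t 1 (F c) ((dE t + c * E t) * expR (c * t)).
  move=> /dEE dEt; rewrite /F; apply: is_derive_eq.
  by rewrite /GRing.scale /= /GRing.scale/=; ring.
have cF c t : J t -> {for t, continuous (F c)}.
  by move=> Jt; exact: is_derive_continuous (dF c t Jt).
have F0 c : F c t0 = 0 by rewrite /F E0 mul0r.
suff Fle c t : J t -> F c t <= 0 -> E t = 0.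
  move=> t Jt; have [t0t|/ltW tt0] := leP t0 t.
    have [c c_tu Kc] := EVT_max t0t (segment_within_continuous hJ J0 Jt cK).
    apply: (Fle (- K c)) => //.
    have [x x_tu|x x_tu] := @MVT_segment _ _
        (fun x => (dE x + - K c * E x) * expR (- K c * x)) _ _ t0t _
        (segment_within_continuous hJ J0 Jt (cF (- K c))).
      exact/dF/(interval_segment hJ J0 Jt)/subset_itv_oo_cc.
    have Jx := interval_segment hJ J0 Jt x_tu.
    rewrite F0 subr0 => ->; rewrite mulr_le0_ge0 ?subr_ge0 //.
    rewrite mulr_le0_ge0 ?expR_ge0 // mulNr subr_le0.
    apply: le_trans (ler_norm _) _; apply: le_trans (dEK _ Jx) _.
    by rewrite ler_wpM2r ?Ege0 // Kc.
  have [c c_tu Kc] := EVT_max tt0 (segment_within_continuous hJ Jt J0 cK).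
  apply: (Fle (K c)) => //.
  have [x x_tu|x x_tu] := @MVT_segment _ _
      (fun x => (dE x + K c * E x) * expR (K c * x)) _ _ tt0 _
      (segment_within_continuous hJ Jt J0 (cF (K c))).
    exact/dF/(interval_segment hJ Jt J0)/subset_itv_oo_cc.
  have Jx := interval_segment hJ Jt J0 x_tu.
  (* On this side the mean value theorem gives [- F t] as a nonnegative slope times [t0 - t]. *)
  rewrite F0 sub0r => /eqP; rewrite eqr_oppLR => /eqP ->.
  rewrite oppr_le0 mulr_ge0 ?subr_ge0 // mulr_ge0 ?expR_ge0 //.
  rewrite addrC -[dE x]opprK subr_ge0.
  apply: le_trans (ler_norm _) _; rewrite normrN; apply: le_trans (dEK _ Jx) _.
  by rewrite ler_wpM2r ?Ege0 // Kc.
move=> Jt; rewrite /F pmulr_lle0 ?expR_gt0 // => E_le0.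
by apply/eqP; rewrite eq_le E_le0 Ege0.
Qed.

Lemma is_derive_sumE (R : realType) (N : nat) (f : 'I_N -> R -> R)
    (df : 'I_N -> R) (t : R) :
  (forall i, is_derive t 1 (f i) (df i)) ->
  is_derive t 1 (fun u => \sum_i f i u) (\sum_i df i).
Proof.
move=> H; have -> : (fun u => \sum_i f i u) = \sum_i f i.
  by apply/funext => u; rewrite fct_sumE.
exact: is_derive_sum.
Qed.

Lemma continuous_sum (R : realType) (I : finType) (P : pred I) (f : I -> R -> R)
    (t : R) :
  (forall i, P i -> {for t, continuous (f i)}) ->
  {for t, continuous (fun u => \sum_(i | P i) f i u)}.
Proof.
move=> H; rewrite /continuous_at /=.
by apply: cvg_big => [|i Pi]; [exact: add_continuous|exact: H].
Qed.

(** The energy, the sum of the squares of all positions and velocities, starts at 0 and satisfies a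
    Gronwall inequality in both time directions. *)
Lemma linear_ode2_unique (R : realType) (N : nat) (J : set R)
    (u du ddu : 'I_N -> R -> R) (A : 'I_N -> 'I_N -> R -> R) (t0 : R) :
  is_interval J -> J t0 -> (forall i, u i t0 = 0) -> (forall i, du i t0 = 0) ->
  (forall i t, J t -> is_derive t 1 (u i) (du i t)) ->
  (forall i t, J t -> is_derive t 1 (du i) (ddu i t)) ->
  (forall i j t, J t -> {for t, continuous (A i j)}) ->
  (forall i t, J t -> ddu i t = \sum_j A i j t * u j t) ->
  forall i t, J t -> u i t = 0.
Proof.
move=> hJ J0 u0 du0 Du Ddu cA uA i t Jt.
pose E s := \sum_i (u i s ^+ 2 + du i s ^+ 2).
(* By [2 |x y| <= x ^ 2 + y ^ 2], the summand 1 controls the products of [u i] and [du i], and the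
   entries of [A] control those of [du i] and [ddu i]. *)
pose K s := 1 + \sum_i \sum_j `|A i j s|.
pose dE s := \sum_i (2 * u i s * du i s + 2 * du i s * ddu i s).
have Ege0 s : 0 <= E s by apply: sumr_ge0 => k _; rewrite addr_ge0 ?sqr_ge0.
(* The two indices are independent because the entry [A k l] couples [du k] to [u l]. *)
have ud_le s k l : u k s ^+ 2 + du l s ^+ 2 <= E s.
  rewrite /E big_split /= lerD //.
    by rewrite (bigD1 k) //= lerDl sumr_ge0 // => ? _; rewrite sqr_ge0.
  by rewrite (bigD1 l) //= lerDl sumr_ge0 // => ? _; rewrite sqr_ge0.
have E0 : E t = 0.
  apply: (@gronwall_eq0 _ J E dE K t0) => //.
  - by rewrite /E big1 // => k _; rewrite u0 du0 !expr0n addr0.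
  - move=> s Js; apply: is_derive_sumE => k.
    have := Du k s Js; have := Ddu k s Js => D1 D2.
    by apply: is_derive_eq; rewrite /GRing.scale /=; ring.
  - move=> s Js; rewrite /continuous_at; apply: cvgD; first exact: cvg_cst.
    apply: (@continuous_sum R _ xpredT) => k _.
    apply: (@continuous_sum R _ xpredT) => l _.
    by apply: cvg_norm; exact: cA.
  - move=> s Js; rewrite /dE big_split /=.
    apply: le_trans (ler_normD _ _) _; rewrite /K mulrDl mul1r lerD //.
      apply: le_trans (ler_norm_sum _ _ _) _; apply: ler_sum => k _.
      have := sqr_ge0 (`|u k s| - `|du k s|);
      rewrite sqrrB !real_normK ?num_real //.
      rewrite !normrM (ger0_norm (ler0n _ 2)); nra.
    under eq_bigr do rewrite uA // mulr_sumr.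
    apply: le_trans (ler_norm_sum _ _ _) _; rewrite mulr_suml.
    apply: ler_sum => k _.
    apply: le_trans (ler_norm_sum _ _ _) _; rewrite mulr_suml.
    apply: ler_sum => l _.
    rewrite !normrM (ger0_norm (ler0n _ 2)).
    have -> : 2 * `|du k s| * (`|A k l s| * `|u l s|) =
      `|A k l s| * (2 * `|du k s| * `|u l s|) by ring.
    rewrite ler_wpM2l //; apply: le_trans (ud_le s l k).
    have := sqr_ge0 (`|u l s| - `|du k s|);
    rewrite sqrrB !real_normK ?num_real //.
    nra.
have := ud_le t i i; rewrite E0 => H; apply/eqP; rewrite -sqrf_eq0 eq_le sqr_ge0.
by rewrite andbT; apply: le_trans H; rewrite lerDl sqr_ge0.
Qed.

Lemma continuous_eq_closure (R : realType) (A : set R) (f g : R -> R) (t : R) :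
  {for t, continuous f} -> {for t, continuous g} ->
  (forall u, A u -> f u = g u) -> closure A t -> f t = g t.
Proof.
move=> cf cg fg At; apply/eqP; rewrite -subr_eq0; apply/negPn/negP => ne0.
have ch : {for t, continuous (fun u => f u - g u)} by exact: cvgB.
have /At [u [Au /=]] : nbhs t [set u | f u - g u != 0].
  have nz : nbhs (f t - g t) [set x : R | x != 0].
    by apply: open_nbhs_nbhs; split => //; exact: open_neq.
  exact: (ch _ nz).
by rewrite fg // subrr eqxx.
Qed.

(** * Rotating frames *)

(* [frame phi psi x y z w] has the radial and tangential components [x], [y] in
   the first plane at angle [phi], and [z], [w] in the second at angle [psi]. *)
Definition frame (R : realType) (phi psi x y z w : R) : 'rV[R]_4 :=
  \row_(k < 4) [:: x * cos phi - y * sin phi; x * sin phi + y * cos phi;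
                   z * cos psi - w * sin psi; z * sin psi + w * cos psi]`_k.

Lemma frameP (R : realType) (phi psi x y z w : R) (v : 'rV[R]_4) :
  [/\ v 0 (inord 0) = x * cos phi - y * sin phi,
      v 0 (inord 1) = x * sin phi + y * cos phi,
      v 0 (inord 2) = z * cos psi - w * sin psi
    & v 0 (inord 3) = z * sin psi + w * cos psi] ->
  v = frame phi psi x y z w.
Proof.
move=> [v0 v1 v2 v3]; apply/rowP => k; rewrite mxE -(inord_val k).
case: k => [[|[|[|[|//]]]] hk] /=; rewrite inordK //=.
Qed.

Lemma frameE (R : realType) (phi psi x y z w : R) :
  let v := frame phi psi x y z w in
  [/\ v 0 (inord 0) = x * cos phi - y * sin phi,
      v 0 (inord 1) = x * sin phi + y * cos phi,
      v 0 (inord 2) = z * cos psi - w * sin psi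
    & v 0 (inord 3) = z * sin psi + w * cos psi].
Proof. by split; rewrite mxE inordK. Qed.

Lemma frameZ (R : realType) (phi psi x y z w c : R) :
  c *: frame phi psi x y z w = frame phi psi (c * x) (c * y) (c * z) (c * w).
Proof. by apply: frameP; split; rewrite !mxE inordK //=; ring. Qed.

Lemma frameB (R : realType) (phi psi x y z w x' y' z' w' : R) :
  frame phi psi x y z w - frame phi psi x' y' z' w' =
  frame phi psi (x - x') (y - y') (z - z') (w - w').
Proof. by apply: frameP; split; rewrite !mxE inordK //=; ring. Qed.

Lemma frame_sum (R : realType) (I : finType) (P : pred I) (phi psi : R)
    (x y z w : I -> R) :
  \sum_(i | P i) frame phi psi (x i) (y i) (z i) (w i) =
  frame phi psi (\sum_(i | P i) x i) (\sum_(i | P i) y i)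
                (\sum_(i | P i) z i) (\sum_(i | P i) w i).
Proof.
by apply: frameP; split; rewrite summxE !mulr_suml -?sumrB -?big_split /=;
  apply: eq_bigr => i _; rewrite mxE inordK.
Qed.

Lemma rotation_inj (R : realType) (phi x y x' y' : R) :
  x * cos phi - y * sin phi = x' * cos phi - y' * sin phi ->
  x * sin phi + y * cos phi = x' * sin phi + y' * cos phi ->
  x = x' /\ y = y'.
Proof.
have := cos2Dsin2 phi; set c := cos phi; set s := sin phi => cs h0 h1.
(* [X] and [Y] undo the rotation, so both pairs of components are recovered from the same rotated
   vector. *)
have X u v : u = (u * c - v * s) * c + (u * s + v * c) * s.
  by rewrite -[LHS]mulr1 -cs; ring.
have Y u v : v = (u * s + v * c) * c - (u * c - v * s) * s.
  by rewrite -[LHS]mulr1 -cs; ring.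
by split; [rewrite (X x y) (X x' y')|rewrite (Y x y) (Y x' y')]; rewrite h0 h1.
Qed.

Lemma frame_eqP (R : realType) (phi psi x y z w x' y' z' w' : R) :
  frame phi psi x y z w = frame phi psi x' y' z' w' <->
  [/\ x = x', y = y', z = z' & w = w'].
Proof.
split=> [|[-> -> -> ->] //].
have [e0 e1 e2 e3] := frameE phi psi x y z w.
have [e0' e1' e2' e3'] := frameE phi psi x' y' z' w'.
move=> E; move: e0 e1 e2 e3; rewrite E {E} e0' e1' e2' e3' => h0 h1 h2 h3.
by have [-> ->] := rotation_inj h0 h1; have [-> ->] := rotation_inj h2 h3.
Qed.

(** This moves a phase from the frame into the components, so that two bodies with different phases
    can be compared in the frame of one of them. *)
Lemma frame_rotate (R : realType) (phi psi a b r rho : R) :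
  frame (phi + a) (psi + b) r 0 rho 0 =
  frame phi psi (r * cos a) (r * sin a) (rho * cos b) (rho * sin b).
Proof.
by apply: frameP; split; rewrite !mxE inordK //= ?cosD ?sinD; ring.
Qed.

Lemma dot_frame (R : realType) (phi psi x y z w x' y' z' w' : R) :
  dot (frame phi psi x y z w) (frame phi psi x' y' z' w') =
  x * x' + y * y' + z * z' + w * w'.
Proof.
rewrite /dot !big_ord_recl big_ord0 !mxE /=.
have := cos2Dsin2 phi; have := cos2Dsin2 psi.
set C := cos psi; set S := sin psi; set c := cos phi; set s := sin phi.
move=> CS cs.
transitivity ((x * x' + y * y') * (c ^+ 2 + s ^+ 2) +
  (z * z' + w * w') * (C ^+ 2 + S ^+ 2)); first by ring.
by rewrite CS cs; ring.
Qed.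

Lemma is_derive_mx (R : realType) (m n : nat) (f : R -> 'M[R]_(m, n))
    (d : 'M[R]_(m, n)) (t : R) :
  (forall i j, is_derive t 1 (fun u => f u i j) (d i j)) -> is_derive t 1 f d.
Proof.
move=> H; have df : derivable f t 1.
  by apply/derivable_mxP => i j; have [] := H i j.
apply: DeriveDef => //; rewrite derive_mx //; apply/matrixP => i j.
by rewrite mxE; have [] := H i j.
Qed.

(** The terms with [dphi] and [dpsi] come from the turning of the basis. A second application
    produces the centripetal and Coriolis terms of the acceleration. *)
Lemma is_derive_frame (R : realType) (phi psi x y z w : R -> R)
    (dphi dpsi dx dy dz dw : R) (t : R) :
  is_derive t 1 phi dphi -> is_derive t 1 psi dpsi ->
  is_derive t 1 x dx -> is_derive t 1 y dy ->
  is_derive t 1 z dz -> is_derive t 1 w dw ->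
  is_derive t 1 (fun u => frame (phi u) (psi u) (x u) (y u) (z u) (w u))
    (frame (phi t) (psi t) (dx - dphi * y t) (dy + dphi * x t)
                           (dz - dpsi * w t) (dw + dpsi * z t)).
Proof.
move=> Dphi Dpsi Dx Dy Dz Dw; apply: is_derive_mx => i k; rewrite (ord1 i) {i}.
have D1 := is_derive1_comp (is_derive_cos (phi t)) Dphi.
have D2 := is_derive1_comp (is_derive_sin (phi t)) Dphi.
have D3 := is_derive1_comp (is_derive_cos (psi t)) Dpsi.
have D4 := is_derive1_comp (is_derive_sin (psi t)) Dpsi.
have dM (f g : R -> R) df dg : is_derive t 1 f df -> is_derive t 1 g dg ->
    is_derive t 1 (fun u => f u * g u) (f t * dg + g t * df).
  by move=> ? ?; exact: is_deriveM.
have dD (f g : R -> R) df dg : is_derive t 1 f df -> is_derive t 1 g dg ->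
    is_derive t 1 (fun u => f u + g u) (df + dg).
  by move=> ? ?; exact: is_deriveD.
have dB (f g : R -> R) df dg : is_derive t 1 f df -> is_derive t 1 g dg ->
    is_derive t 1 (fun u => f u - g u) (df - dg).
  by move=> ? ?; exact: is_deriveB.
rewrite mxE; case: k => [[|[|[|[|//]]]] hk] /=.
- rewrite (_ : (fun u => _) = (fun u => x u * cos (phi u) - y u * sin (phi u))).
    refine (is_derive_eq (dB _ _ _ _ (dM _ _ _ _ Dx D1) (dM _ _ _ _ Dy D2)) _).
    by rewrite /=; ring.
  by apply/funext => u; rewrite mxE.
- rewrite (_ : (fun u => _) = (fun u => x u * sin (phi u) + y u * cos (phi u))).
    refine (is_derive_eq (dD _ _ _ _ (dM _ _ _ _ Dx D2) (dM _ _ _ _ Dy D1)) _).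
    by rewrite /=; ring.
  by apply/funext => u; rewrite mxE.
- rewrite (_ : (fun u => _) = (fun u => z u * cos (psi u) - w u * sin (psi u))).
    refine (is_derive_eq (dB _ _ _ _ (dM _ _ _ _ Dz D3) (dM _ _ _ _ Dw D4)) _).
    by rewrite /=; ring.
  by apply/funext => u; rewrite mxE.
- rewrite (_ : (fun u => _) = (fun u => z u * sin (psi u) + w u * cos (psi u))).
    refine (is_derive_eq (dD _ _ _ _ (dM _ _ _ _ Dz D4) (dM _ _ _ _ Dw D3)) _).
    by rewrite /=; ring.
  by apply/funext => u; rewrite mxE.
Qed.

(** * Radial and tangential forces *)

(** The radii are confined to the interval from 0 to 1, so a radius that reaches an endpoint has an
    extremum there and its velocity vanishes. *)
Lemma open_min_derive1_eq0 (R : realType) (J : set R) (f : R -> R) (t : R) :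
  open J -> J t -> (forall u, J u -> derivable f u 1) ->
  (forall u, J u -> f t <= f u) -> derive1 f t = 0.
Proof.
move=> oJ Jt df ft.
have [e /= e0 eJ] : \forall x \near t, J x by apply: open_nbhs_nbhs; split.
have sJ u : u \in `]t - e, t + e[ -> J u.
  move=> uI; apply: eJ; rewrite /= ltr_norml.
  by move: uI; rewrite in_itv /= => /andP[? ?]; apply/andP; split; lra.
rewrite derive1E; apply: derive_val.
apply: (@derive1_at_min _ f (t - e) (t + e)) => [|u uI||u uI].
- by lra.
- exact/df/sJ.
- by rewrite in_itv /=; apply/andP; split; lra.
- exact/ft/sJ.
Qed.

Lemma open_max_derive1_eq0 (R : realType) (J : set R) (f : R -> R) (t : R) :
  open J -> J t -> (forall u, J u -> derivable f u 1) ->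
  (forall u, J u -> f u <= f t) -> derive1 f t = 0.
Proof.
move=> oJ Jt df ft; apply/eqP; rewrite -oppr_eq0; apply/eqP.
rewrite -derive1N; last exact: df.
apply: (open_min_derive1_eq0 oJ Jt) => u Ju; first exact/derivableN/df.
by rewrite lerN2 ft.
Qed.

(** This is the inner product of two bodies. Unlike [qr] it keeps [rho] as a variable: it is
    polynomial in the radii and symmetric under the exchange of the two planes. *)
Definition pairing (R : realType) (N : nat) (a b r rho : 'I_N -> R)
    (i j : 'I_N) : R :=
  r i * r j * cos (a i - a j) + rho i * rho j * cos (b i - b j).

(** [Q] is arbitrary and only one plane enters, so that the same formula serves for [a], [r] and for
    [b], [rho]. *)
Definition radial_force (R : realType) (N : nat) (m : 'I_N -> R)
    (Q : 'I_N -> 'I_N -> R) (a r : 'I_N -> R) (i : 'I_N) : R :=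
  \sum_(j < N | j != i)
    m j / (1 - Q i j ^+ 2) `^ (3 / 2) * (r j * cos (a j - a i) - Q i j * r i).

(** There is no term with [Q i j * r i], because the position of the [i]-th body has no tangential
    component in its own frame. The shape is that of the right-hand sides in
    [first_order_system]. *)
Definition tangential_force (R : realType) (N : nat) (m : 'I_N -> R)
    (Q : 'I_N -> 'I_N -> R) (a r : 'I_N -> R) (i : 'I_N) : R :=
  \sum_(j < N | j != i)
    m j * r j * sin (a j - a i) / (1 - Q i j ^+ 2) `^ (3 / 2).

Lemma pairing_sym (R : realType) (N : nat) (a b r rho : 'I_N -> R) i j :
  pairing a b r rho i j = pairing a b r rho j i.
Proof.
rewrite /pairing -[cos (a i - a j)]cosN -[cos (b i - b j)]cosN !opprB.
by rewrite (mulrC (r i)) (mulrC (rho i)).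
Qed.

(** The cosines are at most 1 in absolute value, and [r i * r j + rho i * rho j] is at most half the
    sum of the four squares, which is 1. *)
Lemma pairing_sqr_le1 (R : realType) (N : nat) (a b r rho : 'I_N -> R) i j :
  (forall k, 0 <= r k) -> (forall k, 0 <= rho k) ->
  (forall k, r k ^+ 2 + rho k ^+ 2 = 1) -> pairing a b r rho i j ^+ 2 <= 1.
Proof.
move=> r0 p0 rp; rewrite -real_normK ?num_real // expr_le1 // /pairing.
apply: le_trans (ler_normD _ _) _.
rewrite !normrM !(ger0_norm (r0 _)) !(ger0_norm (p0 _)).
have c1 x : `|cos x| <= 1 :> R.
  by rewrite ler_norml cos_geN1 cos_le1.
apply: (@le_trans _ _ (r i * r j + rho i * rho j)).
  by rewrite lerD // ler_piMr ?mulr_ge0.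
have := rp i; have := rp j.
have := sqr_ge0 (r i - r j); have := sqr_ge0 (rho i - rho j); nra.
Qed.

Lemma curved_force_frame (R : realType) (N : nat) (m a b r rho : 'I_N -> R)
    (phi psi : R) (i : 'I_N) :
  let Q := pairing a b r rho in
  curved_force m (fun j => frame (phi + a j) (psi + b j) (r j) 0 (rho j) 0) i =
  frame (phi + a i) (psi + b i)
    (radial_force m Q a r i) (tangential_force m Q a r i)
    (radial_force m Q b rho i) (tangential_force m Q b rho i).
Proof.
(* Every body is written in the frame of the [i]-th one, where the force can be summed component by
   component. *)
move=> Q; have Fj j : frame (phi + a j) (psi + b j) (r j) 0 (rho j) 0 =
    frame (phi + a i) (psi + b i) (r j * cos (a j - a i)) (r j * sin (a j - a i))
      (rho j * cos (b j - b i)) (rho j * sin (b j - b i)).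
  by rewrite -frame_rotate; congr frame; ring.
rewrite /radial_force /tangential_force -frame_sum; apply: eq_bigr => j _.
have -> : dot (frame (phi + a i) (psi + b i) (r i) 0 (rho i) 0)
     (frame (phi + a j) (psi + b j) (r j) 0 (rho j) 0) = Q i j.
  rewrite (Fj j) dot_frame /Q /pairing -(cosN (a i - _)) -(cosN (b i - _)) !opprB.
  by ring.
by rewrite (Fj j) !frameZ frameB frameZ; congr frame; ring.
Qed.

Lemma continuous_coupling (R : realType) (Q : R -> R) (m t : R) :
  {for t, continuous Q} -> 0 < 1 - Q t ^+ 2 ->
  {for t, continuous (fun u => m / (1 - Q u ^+ 2) `^ (3 / 2))}.
Proof.
move=> cQ Q1; apply: cvgM; first exact: cvg_cst.
apply: cvgV; first by rewrite gt_eqF // powR_gt0.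
have cD : {for t, continuous (fun u => 1 - Q u ^+ 2)}.
  by apply: cvgB; [exact: cvg_cst|apply: cvgM; exact: cQ].
apply: (continuous_comp cD (is_derive_continuous (is_derive1_powR _ Q1))).
Qed.

Lemma continuous_radial_force (R : realType) (N : nat) (m : 'I_N -> R)
    (Q : R -> 'I_N -> 'I_N -> R) (a : 'I_N -> R) (r : 'I_N -> R -> R)
    (i : 'I_N) (t : R) :
  (forall i j, {for t, continuous (fun u => Q u i j)}) ->
  (forall i j, i != j -> 0 < 1 - Q t i j ^+ 2) ->
  (forall i, {for t, continuous (r i)}) ->
  {for t, continuous (fun u => radial_force m (Q u) a (r^~ u) i)}.
Proof.
move=> cQ Q1 cr; apply: continuous_sum => j ji.
apply: cvgM; first by apply: continuous_coupling; rewrite ?Q1 1?eq_sym.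
apply: cvgB; apply: cvgM; [exact: cr|exact: cvg_cst|exact: cQ|exact: cr].
Qed.

(* A vanishing nonnegative configuration has zero velocity, and the radial
   equations are linear in [r] once [Q] and [W] are regarded as given. *)
Lemma radial_equation_unique (R : realType) (N : nat) (J : set R)
    (m a : 'I_N -> R) (Q : R -> 'I_N -> 'I_N -> R) (W r : 'I_N -> R -> R)
    (t0 : R) :
  open J -> is_interval J -> J t0 ->
  (forall i, C2_on J (r i)) -> (forall i t, J t -> 0 <= r i t) ->
  (forall i j t, J t -> {for t, continuous (fun u => Q u i j)}) ->
  (forall i j t, J t -> i != j -> 0 < 1 - Q t i j ^+ 2) ->
  (forall i t, J t -> {for t, continuous (W i)}) ->
  (forall i t, J t -> derive1n 2 (r i) t =
     radial_force m (Q t) a (r^~ t) i + W i t * r i t) ->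
  (forall i, r i t0 = 0) -> forall i t, J t -> r i t = 0.
Proof.
move=> oJ hJ J0 C2r rge0 cQ Q1 cW req r0.
pose c i j t := m j / (1 - Q t i j ^+ 2) `^ (3 / 2).
have cc i j t : J t -> i != j -> {for t, continuous (c i j)}.
  by move=> Jt ij; apply: continuous_coupling; [exact: cQ|exact: Q1].
(* The diagonal entry gathers [W i] and the terms [Q i j * r i] of all the summands of the radial
   force. *)
pose A i j t := if j != i then c i j t * cos (a j - a i)
  else W i t - \sum_(k < N | k != i) c i k t * Q t i k.
refine (@linear_ode2_unique _ _ J r (fun i => derive1 (r i))
  (fun i => derive1n 2 (r i)) A t0 hJ J0 r0 _ _ _ _ _).
- move=> i; apply: (open_min_derive1_eq0 oJ J0) => u Ju.
    by have [] := C2r i u Ju.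
  by rewrite r0 rge0.
- by move=> i t Jt; apply: is_derive1P; have [] := C2r i t Jt.
- move=> i t Jt; have [_ d2 _] := C2r i t Jt.
  have D := is_derive1P d2.
  exact: D.
- move=> i j t Jt; rewrite /A; case ji: (j != i).
    apply: cvgM; last exact: cvg_cst.
    by apply: cc; rewrite // eq_sym.
  apply: cvgB; first exact: cW.
  apply: continuous_sum => k ki; apply: cvgM; last exact: cQ.
  by apply: cc; rewrite // eq_sym.
- move=> i t Jt; rewrite req // (bigD1 i) //=.
  have -> : A i i t = W i t - \sum_(k < N | k != i) c i k t * Q t i k.
    by rewrite /A eqxx.
  rewrite mulrBl -addrA [LHS]addrC; congr (_ + _).
  rewrite [RHS]addrC mulr_suml -sumrB.
  by apply: eq_bigr => j ji; rewrite /A ji /c; ring.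
Qed.

Lemma antisymmetric_sum0 (R : realType) (N : nat) (F : 'I_N -> 'I_N -> R) :
  (forall i j, F i j = - F j i) -> \sum_i \sum_(j < N | j != i) F i j = 0.
Proof.
move=> FN; set S := LHS; suff SN : S = - S by lra.
rewrite {1}/S (exchange_big_dep xpredT) //= -sumrN; apply: eq_bigr => j _.
by rewrite -sumrN; apply: eq_big => [i|i _]; rewrite 1?eq_sym // FN.
Qed.

(** Action equals reaction: the torque of [j] on [i] contains [sin (a j - a i)] times a factor
    symmetric in [i] and [j]. *)
Lemma total_torque0 (R : realType) (N : nat) (m : 'I_N -> R)
    (Q : 'I_N -> 'I_N -> R) (a r : 'I_N -> R) :
  (forall i j, Q i j = Q j i) ->
  \sum_i m i * r i * tangential_force m Q a r i = 0.
Proof.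
move=> Qsym; under eq_bigr do rewrite mulr_sumr.
apply: antisymmetric_sum0 => i j.
by rewrite (Qsym i j) -(opprB (a i)) sinN; ring.
Qed.

(** * Equations of motion in polar form *)

(** The polar form and the constraint hold only at times in [J]. As [J] is open, identities there
    may still be differentiated. *)
Lemma open_near_eq_is_derive (R : realType) (V : normedModType R) (J : set R)
    (f g : R -> V) (t : R) (d : V) :
  open J -> J t -> (forall u, J u -> f u = g u) ->
  is_derive t 1 g d -> is_derive t 1 f d.
Proof.
move=> oJ Jt fg; apply: near_eq_is_derive.
have : \forall u \near t, J u by apply: open_nbhs_nbhs; split.
by apply: filterS => u /fg ->.
Qed.

Definition speed_sq (R : realType) (alpha beta r rho : R -> R) (t : R) : R :=
  derive1 r t ^+ 2 + (r t * derive1 alpha t) ^+ 2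
  + derive1 rho t ^+ 2 + (rho t * derive1 beta t) ^+ 2.

(** These are the four components of the equation of motion in the frame of the [i]-th body. The
    constraint force [v2] points along the position, hence occurs in the radial equations only. *)
Definition polar_motion (R : realType) (N : nat) (m a b : 'I_N -> R)
    (alpha beta : R -> R) (r rho : 'I_N -> R -> R) (i : 'I_N) (t : R) : Prop :=
  let Q := pairing a b (r^~ t) (rho^~ t) in
  let v2 := speed_sq alpha beta (r i) (rho i) t in
  [/\ derive1n 2 (r i) t - r i t * derive1 alpha t ^+ 2
        = radial_force m Q a (r^~ t) i - v2 * r i t,
      r i t * derive1n 2 alpha t + 2 * derive1 (r i) t * derive1 alpha t
        = tangential_force m Q a (r^~ t) i,
      derive1n 2 (rho i) t - rho i t * derive1 beta t ^+ 2
        = radial_force m Q b (rho^~ t) i - v2 * rho i t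
    & rho i t * derive1n 2 beta t + 2 * derive1 (rho i) t * derive1 beta t
        = tangential_force m Q b (rho^~ t) i].

Lemma C2_onP (R : realType) (J : set R) (f : R -> R) (t : R) :
  C2_on J f -> J t ->
  [/\ is_derive t 1 f (derive1 f t),
      is_derive t 1 (derive1 f) (derive1n 2 f t)
    & {for t, continuous (derive1n 2 f)}].
Proof.
move=> C2f Jt; have [d1 d2 c2] := C2f t Jt.
have D1 := is_derive1P d1; have D2 := is_derive1P d2.
by split; [exact: D1|exact: D2|exact: c2].
Qed.

(** * Kinematics of the elliptic-elliptic form *)

Section elliptic_elliptic.
Context (R : realType) (N : nat) (J : set R) (oJ : open J).
Context (q : 'I_N -> R -> 'rV[R]_4) (a b : 'I_N -> R) (alpha beta : R -> R).
Context (r rho : 'I_N -> R -> R).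
Context (hq : elliptic_elliptic_form J q a b alpha beta r rho).

Lemma form_frame i t : J t ->
  q i t = frame (alpha t + a i) (beta t + b i) (r i t) 0 (rho i t) 0.
Proof.
have [_ _ _ _ qE] := hq; move=> Jt; rewrite qE //.
by apply: frameP; split; rewrite mxE inordK //= mul0r ?subr0 ?addr0.
Qed.

Lemma form_bounds i t : J t ->
  [/\ 0 <= r i t <= 1, 0 <= rho i t <= 1 & r i t ^+ 2 + rho i t ^+ 2 = 1].
Proof. by have [_ _ _ H _] := hq; exact: H. Qed.

Lemma form_r i : C2_on J (r i).
Proof. by have [[_ _ C2 _] _ _ _ _] := hq; exact: C2. Qed.

Lemma form_rho i : C2_on J (rho i).
Proof. by have [[_ _ _ C2] _ _ _ _] := hq; exact: C2. Qed.

Lemma form_alpha : C2_on J alpha.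
Proof. by have [[C2 _ _ _] _ _ _ _] := hq; exact: C2. Qed.

Lemma form_beta : C2_on J beta.
Proof. by have [[_ C2 _ _] _ _ _ _] := hq; exact: C2. Qed.

Lemma form_rhoE i t : J t -> rho i t = Num.sqrt (1 - r i t ^+ 2).
Proof.
move=> /(form_bounds i)[_ /andP[rho0 _] <-].
by rewrite addrAC subrr add0r sqrtr_sqr ger0_norm.
Qed.

Lemma form_qr i j t : J t ->
  qr a b (r^~ t) i j = pairing a b (r^~ t) (rho^~ t) i j.
Proof. by move=> Jt; rewrite /qr /pairing -!form_rhoE. Qed.

Lemma form_dot i j t : J t ->
  dot (q i t) (q j t) = pairing a b (r^~ t) (rho^~ t) i j.
Proof.
move=> Jt; rewrite !form_frame // /pairing.
have -> : frame (alpha t + a i) (beta t + b i) (r i t) 0 (rho i t) 0 =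
    frame (alpha t + a j) (beta t + b j) (r i t * cos (a i - a j))
      (r i t * sin (a i - a j)) (rho i t * cos (b i - b j))
      (rho i t * sin (b i - b j)).
  by rewrite -frame_rotate; congr frame; ring.
by rewrite dot_frame; ring.
Qed.

Lemma is_derive_form i t : J t ->
  is_derive t 1 (q i)
    (frame (alpha t + a i) (beta t + b i)
      (derive1 (r i) t) (r i t * derive1 alpha t)
      (derive1 (rho i) t) (rho i t * derive1 beta t)).
Proof.
move=> Jt; apply: (open_near_eq_is_derive oJ Jt (form_frame i)).
have [Dr _ _] := C2_onP (form_r i) Jt; have [Drho _ _] := C2_onP (form_rho i) Jt.
have [Dal _ _] := C2_onP form_alpha Jt; have [Dbe _ _] := C2_onP form_beta Jt.
have Da := is_deriveD Dal (is_derive_cst (a i) t 1).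
have Db := is_deriveD Dbe (is_derive_cst (b i) t 1).
have D := is_derive_frame Da Db Dr (is_derive_cst (0 : R) t 1)
  Drho (is_derive_cst (0 : R) t 1).
by refine (is_derive_eq D _); rewrite !fctE /cst !addr0; congr frame; ring.
Qed.

Lemma is_derive2_form i t : J t ->
  is_derive t 1 (derive1 (q i))
    (frame (alpha t + a i) (beta t + b i)
      (derive1n 2 (r i) t - r i t * derive1 alpha t ^+ 2)
      (r i t * derive1n 2 alpha t + 2 * derive1 (r i) t * derive1 alpha t)
      (derive1n 2 (rho i) t - rho i t * derive1 beta t ^+ 2)
      (rho i t * derive1n 2 beta t + 2 * derive1 (rho i) t * derive1 beta t)).
Proof.
move=> Jt.
apply: (@open_near_eq_is_derive _ _ J _
  (fun t => frame (alpha t + a i) (beta t + b i)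
      (derive1 (r i) t) (r i t * derive1 alpha t)
      (derive1 (rho i) t) (rho i t * derive1 beta t)) _ _ oJ Jt).
  by move=> u Ju; rewrite derive1E; have [_ ->] := is_derive_form i Ju.
have [Dr DDr _] := C2_onP (form_r i) Jt.
have [Drho DDrho _] := C2_onP (form_rho i) Jt.
have [Dal DDal _] := C2_onP form_alpha Jt.
have [Dbe DDbe _] := C2_onP form_beta Jt.
have Da := is_deriveD Dal (is_derive_cst (a i) t 1).
have Db := is_deriveD Dbe (is_derive_cst (b i) t 1).
have D := is_derive_frame Da Db DDr (is_deriveM Dr DDal)
  DDrho (is_deriveM Drho DDbe).
refine (is_derive_eq D _); rewrite !fctE /cst !addr0 /GRing.scale /=.
by congr frame; ring.
Qed.

Lemma curved_force_form m i t : J t ->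
  let Q := pairing a b (r^~ t) (rho^~ t) in
  curved_force m (fun j => q j t) i =
  frame (alpha t + a i) (beta t + b i)
    (radial_force m Q a (r^~ t) i) (tangential_force m Q a (r^~ t) i)
    (radial_force m Q b (rho^~ t) i) (tangential_force m Q b (rho^~ t) i).
Proof.
move=> Jt Q; rewrite -curved_force_frame.
have -> // : (fun j => q j t) =
  fun j => frame (alpha t + a j) (beta t + b j) (r j t) 0 (rho j t) 0.
by apply/funext => j; rewrite form_frame.
Qed.

Lemma motion_polarP m t i : J t ->
  derive1n 2 (q i) t = curved_force m (fun j => q j t) i
     - dot (derive1 (q i) t) (derive1 (q i) t) *: q i t <->
  polar_motion m a b alpha beta r rho i t.
Proof.
move=> Jt; have -> : derive1n 2 (q i) t = 'D_1 (derive1 (q i)) t.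
  by rewrite -derive1E.
have [_ ->] := is_derive2_form i Jt.
have -> : derive1 (q i) t = frame (alpha t + a i) (beta t + b i)
    (derive1 (r i) t) (r i t * derive1 alpha t)
    (derive1 (rho i) t) (rho i t * derive1 beta t).
  by rewrite derive1E; have [_ ->] := is_derive_form i Jt.
rewrite curved_force_form // form_frame // dot_frame.
set v2 := (X in X *: _).
have -> : v2 = speed_sq alpha beta (r i) (rho i) t by rewrite /v2 /speed_sq; ring.
rewrite frameZ frameB !mulr0 !subr0.
exact: frame_eqP.
Qed.

(** Differentiability and unit length follow from the form, which leaves the absence of singular
    pairs and the four components of the equation of motion. *)
Lemma solution_polarP m :
  solution J m q <->
  forall t, J t ->
    (forall i j, i != j -> pairing a b (r^~ t) (rho^~ t) i j ^+ 2 != 1) /\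
    (forall i, polar_motion m a b alpha beta r rho i t).
Proof.
split=> [sol t Jt|pol t Jt].
- have [ne sol_t] := sol t Jt; split=> [i j ij|i]; first by rewrite -form_dot ?ne.
  by have [_ _ _ E] := sol_t i; exact/motion_polarP.
- have [ne pol_t] := pol t Jt; split=> [i j ij|i]; first by rewrite form_dot ?ne.
  split.
  + by have [] := is_derive_form i Jt.
  + by have [] := is_derive2_form i Jt.
  + rewrite form_dot // /pairing !subrr cos0 !mulr1 -!expr2.
    by have [_ _ ->] := form_bounds i Jt.
  + by apply/motion_polarP.
Qed.

Lemma form_pairing_lt1 t i j : J t ->
  pairing a b (r^~ t) (rho^~ t) i j ^+ 2 != 1 ->
  0 < 1 - pairing a b (r^~ t) (rho^~ t) i j ^+ 2.
Proof.
move=> Jt ne1; rewrite subr_gt0 lt_neqAle ne1 /=.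
by apply: pairing_sqr_le1 => k; have [/andP[+ _] /andP[+ _]] := form_bounds k Jt.
Qed.

Lemma form_continuous_pairing t i j : J t ->
  {for t, continuous (fun u => pairing a b (r^~ u) (rho^~ u) i j)}.
Proof.
move=> Jt.
have cr k : {for t, continuous (r k)}.
  by have [/is_derive_continuous] := C2_onP (form_r k) Jt.
have cp k : {for t, continuous (rho k)}.
  by have [/is_derive_continuous] := C2_onP (form_rho k) Jt.
apply: cvgD; (apply: cvgM; last exact: cvg_cst).
- by apply: cvgM; exact: cr.
- by apply: cvgM; exact: cp.
Qed.

Lemma form_continuous_speed_sq t i : J t ->
  {for t, continuous (speed_sq alpha beta (r i) (rho i))}.
Proof.
move=> Jt.
have [/is_derive_continuous cr /is_derive_continuous cdr _] :=
  C2_onP (form_r i) Jt.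
have [/is_derive_continuous cp /is_derive_continuous cdp _] :=
  C2_onP (form_rho i) Jt.
have [_ /is_derive_continuous cda _] := C2_onP form_alpha Jt.
have [_ /is_derive_continuous cdb _] := C2_onP form_beta Jt.
have csq (f : R -> R) : {for t, continuous f} ->
    {for t, continuous (fun u => f u ^+ 2)} by move=> cf; apply: cvgM; exact: cf.
apply: cvgD; [apply: cvgD; [apply: cvgD|]|].
- exact: csq.
- by apply: (csq (fun u => r i u * derive1 alpha u)); apply: cvgM.
- exact: csq.
- by apply: (csq (fun u => rho i u * derive1 beta u)); apply: cvgM.
Qed.

End elliptic_elliptic.

(** * Momenta and the function G *)

Lemma inertia_eq0 (R : realType) (N : nat) (m r : 'I_N -> R) :
  (forall i, 0 < m i) -> inertia m r = 0 -> forall i, r i = 0.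
Proof.
move=> hm /eqP; rewrite psumr_eq0 => [/allP H i|i _].
  have := H i (mem_index_enum i); rewrite mulf_eq0 gt_eqF //=.
  by rewrite sqrf_eq0 => /eqP.
by rewrite mulr_ge0 ?sqr_ge0 // ltW.
Qed.

(** The derivative of [r i ^ 2 * alpha'] is [r i] times the left-hand side of the tangential
    equation, so the derivative of the momentum is the total torque. *)
Lemma momentum_constant (R : realType) (N : nat) (J : set R) (m a : 'I_N -> R)
    (alpha : R -> R) (r : 'I_N -> R -> R) (Q : R -> 'I_N -> 'I_N -> R) :
  is_interval J -> C2_on J alpha -> (forall i, C2_on J (r i)) ->
  (forall t i j, Q t i j = Q t j i) ->
  (forall i t, J t ->
     r i t * derive1n 2 alpha t + 2 * derive1 (r i) t * derive1 alpha t
       = tangential_force m (Q t) a (r^~ t) i) ->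
  constant_over J (fun t => inertia m (r^~ t) * derive1 alpha t).
Proof.
move=> hJ C2a C2r Qsym teq; apply: derive0_constant_over => // t Jt.
have [_ DDa _] := C2_onP C2a Jt.
have Dm i : is_derive t 1 (fun u => m i * r i u ^+ 2)
    (m i * (2 * r i t * derive1 (r i) t)).
  have [Dr _ _] := C2_onP (C2r i) Jt.
  have D := is_deriveM (is_derive_cst (m i) t 1) (is_deriveM Dr Dr).
  refine (is_derive_eq D _).
  by rewrite !fctE /cst /GRing.scale /=; ring.
refine (is_derive_eq (is_deriveM (is_derive_sumE Dm) DDa) _).
rewrite /GRing.scale /=; apply: etrans (total_torque0 m a (r^~ t) (Qsym t)).
rewrite mulr_suml mulr_sumr -big_split /=; apply: eq_bigr => i _.
by rewrite -teq // derive1nS derive1n1; ring.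
Qed.

(** A zero of the inertia would make all radii vanish for all time, by uniqueness for the radial
    equations. A zero momentum would then make [alpha] constant. *)
Lemma momentum_neq0 (R : realType) (N : nat) (J : set R) (m a : 'I_N -> R)
    (alpha : R -> R) (W r : 'I_N -> R -> R) (Q : R -> 'I_N -> 'I_N -> R) :
  open J -> is_interval J -> (forall i, 0 < m i) ->
  C2_on J alpha -> ~ constant_over J alpha ->
  (forall i, C2_on J (r i)) -> (forall i t, J t -> 0 <= r i t) ->
  ~ (forall i t, J t -> r i t = 0) ->
  (forall t i j, Q t i j = Q t j i) ->
  (forall i j t, J t -> {for t, continuous (fun u => Q u i j)}) ->
  (forall i j t, J t -> i != j -> 0 < 1 - Q t i j ^+ 2) ->
  (forall i t, J t -> {for t, continuous (W i)}) ->
  (forall i t, J t -> derive1n 2 (r i) t =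
     radial_force m (Q t) a (r^~ t) i + W i t * r i t) ->
  (forall i t, J t ->
     r i t * derive1n 2 alpha t + 2 * derive1 (r i) t * derive1 alpha t
       = tangential_force m (Q t) a (r^~ t) i) ->
  exists2 c, c != 0 & forall t, J t ->
    inertia m (r^~ t) != 0 /\ derive1 alpha t = c / inertia m (r^~ t).
Proof.
move=> oJ hJ hm C2a anc C2r r0 rn0 Qsym cQ Q1 cW req teq.
have In0 t : J t -> inertia m (r^~ t) != 0.
  move=> Jt; apply/eqP => /(inertia_eq0 hm) rt0; apply: rn0.
  exact: (radial_equation_unique oJ hJ Jt C2r r0 cQ Q1 cW req rt0).
have momc := momentum_constant hJ C2a C2r Qsym teq.
(* On an empty set of times [alpha] would be constant. *)
have [t0 J0] : exists t, J t.
  apply: contrapT => nJ; apply: anc => t u Jt; exfalso; apply: nJ; by exists t.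
exists (inertia m (r^~ t0) * derive1 alpha t0).
  apply/eqP => c0; apply: anc; apply: derive0_constant_over => // t Jt.
  have [Da _ _] := C2_onP C2a Jt; refine (is_derive_eq Da _).
  have /eqP := momc t t0 Jt J0; rewrite c0 mulf_eq0 (negbTE (In0 t Jt)) /=.
  by move/eqP.
move=> t Jt; split; first exact: In0.
by rewrite -(momc t t0 Jt J0) mulrC mulKf ?In0.
Qed.

Lemma pairing_swap (R : realType) (N : nat) (a b r rho : 'I_N -> R) i j :
  pairing a b r rho i j = pairing b a rho r i j.
Proof. by rewrite /pairing addrC. Qed.

(** All the bodies then lie on the unit circle of the second plane and turn by the common angle
    [beta]. *)
Lemma pairing_constant (R : realType) (N : nat) (J : set R) (a b : 'I_N -> R)
    (r rho : 'I_N -> R -> R) (i j : 'I_N) :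
  (forall i t, J t -> r i t = 0) -> (forall i t, J t -> 0 <= rho i t) ->
  (forall i t, J t -> r i t ^+ 2 + rho i t ^+ 2 = 1) ->
  constant_over J (fun t => pairing a b (r^~ t) (rho^~ t) i j).
Proof.
move=> r0 p0 rp.
have p1 k t : J t -> rho k t = 1.
  move=> Jt; have := rp k t Jt; rewrite r0 // expr0n add0r => /eqP.
  by rewrite sqrp_eq1 ?p0 // => /eqP.
by move=> t u Jt Ju; rewrite /pairing !r0 // !p1.
Qed.

(** * The radial equations under the constraint *)

Section equations.
Context (R : realType) (N : nat) (J : set R) (oJ : open J).
Context (m : 'I_N -> R).
Context (q : 'I_N -> R -> 'rV[R]_4) (a b : 'I_N -> R) (alpha beta : R -> R).
Context (r rho : 'I_N -> R -> R).
Context (hq : elliptic_elliptic_form J q a b alpha beta r rho).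

Let Q t := pairing a b (r^~ t) (rho^~ t).

Lemma form_constraint1 i t : J t ->
  r i t * derive1 (r i) t + rho i t * derive1 (rho i) t = 0.
Proof.
move=> Jt; have [Dr _ _] := C2_onP (form_r hq i) Jt.
have [Dp _ _] := C2_onP (form_rho hq i) Jt.
have [_ D] := is_deriveD (is_deriveM Dr Dr) (is_deriveM Dp Dp).
have [_] : is_derive t 1 (r i * r i + rho i * rho i) (0 : R).
  apply: (open_near_eq_is_derive oJ Jt _ (is_derive_cst (1 : R) t 1)) => u Ju.
  by have [_ _ <-] := form_bounds hq i Ju; rewrite !fctE !expr2.
by rewrite D /GRing.scale /=; lra.
Qed.

Lemma form_constraint2 i t : J t ->
  r i t * derive1n 2 (r i) t + derive1 (r i) t ^+ 2
  + rho i t * derive1n 2 (rho i) t + derive1 (rho i) t ^+ 2 = 0.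
Proof.
move=> Jt; have [Dr DDr _] := C2_onP (form_r hq i) Jt.
have [Dp DDp _] := C2_onP (form_rho hq i) Jt.
have [_ D] := is_deriveD (is_deriveM Dr DDr) (is_deriveM Dp DDp).
have [_] : is_derive t 1
    (r i * derive1 (r i) + rho i * derive1 (rho i)) (0 : R).
  apply: (open_near_eq_is_derive oJ Jt _ (is_derive_cst (0 : R) t 1)) => u Ju.
  exact: form_constraint1.
rewrite D /GRing.scale /=.
move: (derive1 (derive1 _) t) (derive1 (derive1 _) t) => A B <-; ring.
Qed.

(** Expanding [Q i j] in [r j * cos (a j - a i) - Q i j * r i] gives the bracket in the sum of [G],
    which is therefore the radial force. *)
Lemma G_radial c1 c2 i s t : J t ->
  derive1 alpha t = c1 / inertia m (r^~ t) ->
  derive1 beta t = c2 / (total_mass m - inertia m (r^~ t)) ->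
  G m a b c1 c2 i (r^~ t) s =
  r i t * rho i t ^+ 2 * (derive1 alpha t ^+ 2 - derive1 beta t ^+ 2)
  - r i t * s ^+ 2 / rho i t ^+ 2
  + radial_force m (Q t) a (r^~ t) i.
Proof.
move=> Jt -> ->; rewrite /G -!expr_div_n.
have p2 : 1 - r i t ^+ 2 = rho i t ^+ 2.
  by have [_ _ <-] := form_bounds hq i Jt; ring.
rewrite p2; congr (_ + _); apply: eq_bigr => j _.
rewrite (form_qr hq _ _ Jt) -/(Q t i j) -p2 -!(form_rhoE hq _ Jt).
rewrite -[cos (a j - a i)]cosN opprB /Q /pairing.
by move: (powR _ _) => D; ring.
Qed.

(** Where [rho i] is nonzero, the constraint gives [rho' = - r r' / rho], hence
    [r' ^ 2 + rho' ^ 2 = r' ^ 2 / rho ^ 2], the quotient that occurs in [G]. *)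
Lemma radial_GP c1 c2 i t : J t ->
  derive1 alpha t = c1 / inertia m (r^~ t) ->
  derive1 beta t = c2 / (total_mass m - inertia m (r^~ t)) ->
  derive1n 2 (r i) t - r i t * derive1 alpha t ^+ 2
    = radial_force m (Q t) a (r^~ t) i
      - speed_sq alpha beta (r i) (rho i) t * r i t <->
  derive1n 2 (r i) t = G m a b c1 c2 i (r^~ t) (derive1 (r i) t).
Proof.
move=> Jt Ha Hb; rewrite (G_radial i _ Jt Ha Hb) /speed_sq.
have [/andP[r0 r1] /andP[p0 p1] rp] := form_bounds hq i Jt.
have := form_constraint1 i Jt.
(* If [rho i] is 0, then [r i] is at its maximum and [rho i] at its minimum, so both velocities
   vanish. The quotient in [G] is 0 / 0, which evaluates to 0, and both equations say that [r''] is
   the radial force. *)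
have [p0'|pn0] := eqVneq (rho i t) 0.
  have r1' : r i t = 1.
    by apply/eqP; rewrite -sqrp_eq1 // -rp p0' expr0n addr0.
  have dr0 : derive1 (r i) t = 0.
    apply: (open_max_derive1_eq0 oJ Jt) => u Ju.
      by have [d1 _ _] := form_r hq i Ju; exact: d1.
    by rewrite r1'; have [/andP[]] := form_bounds hq i Ju.
  have dp0 : derive1 (rho i) t = 0.
    apply: (open_min_derive1_eq0 oJ Jt) => u Ju.
      by have [d1 _ _] := form_rho hq i Ju; exact: d1.
    by rewrite p0'; have [_ /andP[]] := form_bounds hq i Ju.
  rewrite r1' p0' dr0 dp0 => _.
  move: (derive1n 2 _ t) (radial_force _ _ _ _ _) => A F.
  by split => H; [|]; lra.
move: rp; move: (derive1 (r i) t) (derive1 (rho i) t) (derive1 alpha t)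
  (derive1 beta t) (derive1n 2 (r i) t) (radial_force _ _ _ _ _)
  => dr dp A B ddr F.
move=> rp c1E.
have -> : dp = - r i t * dr / rho i t.
  by apply: (mulfI pn0); rewrite [RHS]mulrC divfK //; lra.
have -> : r i t * dr ^+ 2 / rho i t ^+ 2 =
    r i t * dr ^+ 2 + r i t * (- r i t * dr / rho i t) ^+ 2.
  have <- : (r i t ^+ 2 + rho i t ^+ 2) * (r i t * dr ^+ 2 / rho i t ^+ 2)
      = r i t * dr ^+ 2 / rho i t ^+ 2.
    by rewrite rp mul1r.
  by field.
set Y := (- r i t * dr / rho i t) ^+ 2.
have p2 : rho i t ^+ 2 = 1 - r i t ^+ 2 by rewrite -rp; ring.
by rewrite !exprMn p2; split => H; lra.
Qed.

(* The component of the equation of motion along [q i] is the second derivative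
   of the constraint, which gives the second radial equation where [rho i] does
   not vanish. *)
Lemma radial_rho_of_r i t : J t -> rho i t != 0 ->
  derive1n 2 (r i) t - r i t * derive1 alpha t ^+ 2
    = radial_force m (Q t) a (r^~ t) i
      - speed_sq alpha beta (r i) (rho i) t * r i t ->
  derive1n 2 (rho i) t - rho i t * derive1 beta t ^+ 2
    = radial_force m (Q t) b (rho^~ t) i
      - speed_sq alpha beta (r i) (rho i) t * rho i t.
Proof.
move=> Jt pn0 req; apply: (mulfI pn0).
have [_ _ rp] := form_bounds hq i Jt.
(* The force is tangent to the sphere: [q j - Q i j * q i] is orthogonal to [q i]. *)
have F0 : r i t * radial_force m (Q t) a (r^~ t) i
    + rho i t * radial_force m (Q t) b (rho^~ t) i = 0.
  rewrite /radial_force !mulr_sumr -big_split /= big1 // => j _.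
  set c := m j / _.
  rewrite -[cos (a j - a i)]cosN -[cos (b j - b i)]cosN !opprB.
  transitivity (c * Q t i j * (1 - (r i t ^+ 2 + rho i t ^+ 2))).
    by rewrite /Q /pairing; ring.
  by rewrite rp subrr mulr0.
have := form_constraint2 i Jt.
move: req F0; rewrite /speed_sq.
move: (derive1 (r i) t) (derive1 (rho i) t) (derive1 alpha t)
  (derive1 beta t) (derive1n 2 (r i) t) (derive1n 2 (rho i) t)
  (radial_force _ _ a _ _) (radial_force _ _ b _ _) rp => dr dp A B ddr ddp F H.
move: (r i t) (rho i t) => x y xy.
set v := dr ^+ 2 + _ + _ + _.
have V : v * (x ^+ 2 + y ^+ 2) = v by rewrite xy mulr1.
have vE : v = dr ^+ 2 + x ^+ 2 * A ^+ 2 + dp ^+ 2 + y ^+ 2 * B ^+ 2.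
  by rewrite /v !exprMn.
move: v V vE => v V vE E1 E2 E3.
(* With the radial equation multiplied by [x], the goal is a linear combination of [V], [vE], the
   orthogonality [E2] and the differentiated constraint [E3]. *)
have xE1 : x * ddr = x * (x * A ^+ 2 + F - v * x) by congr (_ * _); lra.
lra.
Qed.

End equations.

(** * Equivalence *)

Lemma eq_constant_over (R : realType) (J : set R) (f g : R -> R) :
  (forall t, J t -> f t = g t) -> constant_over J f -> constant_over J g.
Proof. by move=> fg cf t u Jt Ju; rewrite -!fg //; exact: cf. Qed.

Lemma eq_tangential_force (R : realType) (N : nat) (m : 'I_N -> R)
    (Q Q' : 'I_N -> 'I_N -> R) (a r : 'I_N -> R) (i : 'I_N) :
  (forall j, Q i j = Q' i j) ->
  tangential_force m Q a r i = tangential_force m Q' a r i.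
Proof. by move=> QQ; apply: eq_bigr => j _; rewrite QQ. Qed.

Section equivalence.
Context (R : realType) (N : nat) (J : set R) (oJ : open J) (hJ : is_interval J).
Context (m : 'I_N -> R) (hm : forall i, 0 < m i).
Context (q : 'I_N -> R -> 'rV[R]_4) (a b : 'I_N -> R) (alpha beta : R -> R).
Context (r rho : 'I_N -> R -> R).
Context (hq : elliptic_elliptic_form J q a b alpha beta r rho).

Lemma inertia_rho t : J t ->
  inertia m (rho^~ t) = total_mass m - inertia m (r^~ t).
Proof.
move=> Jt; rewrite /total_mass /inertia -sumrB; apply: eq_bigr => k _.
have [_ _ rp] := form_bounds hq k Jt.
by rewrite -[X in X - _]mulr1 -rp; ring.
Qed.

(** A nonconstant [q_ij] prevents either family of radii from vanishing identically, so the momentum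
    argument applies in both planes. The functions [s i] are the derivatives of the [r i]. *)
Lemma solution_pulsation : (0 < N)%N -> solution J m q ->
  ~ (forall i j, i != j -> constant_over J (fun t => dot (q i t) (q j t))) ->
  pulsation_equations J m a b alpha beta r rho.
Proof.
move=> N0 /(solution_polarP oJ hq) pol nc.
have r0 i t : J t -> 0 <= r i t.
  by move=> Jt; have [/andP[]] := form_bounds hq i Jt.
have p0 i t : J t -> 0 <= rho i t.
  by move=> Jt; have [_ /andP[]] := form_bounds hq i Jt.
have rp i t : J t -> r i t ^+ 2 + rho i t ^+ 2 = 1.
  by move=> Jt; have [] := form_bounds hq i Jt.
have Q1 i j t : J t -> i != j -> 0 < 1 - pairing a b (r^~ t) (rho^~ t) i j ^+ 2.
  by move=> Jt ij; apply: (form_pairing_lt1 hq) => //; apply: (pol t Jt).1.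
have cQ i j t : J t ->
    {for t, continuous (fun u => pairing a b (r^~ u) (rho^~ u) i j)}.
  by move=> Jt; exact: (form_continuous_pairing hq).
have cv i t : J t -> {for t, continuous (speed_sq alpha beta (r i) (rho i))}.
  by move=> Jt; exact: (form_continuous_speed_sq hq).
have [_ anc bnc _ _] := hq.
have [c1 c10 Hc1] : exists2 c, c != 0 & forall t, J t ->
    inertia m (r^~ t) != 0 /\ derive1 alpha t = c / inertia m (r^~ t).
  (* The coefficient of [r i] joins the centripetal term, moved to the right, and the constraint
     force. *)
  apply: (@momentum_neq0 _ _ J m a alpha
    (fun i t => derive1 alpha t ^+ 2 - speed_sq alpha beta (r i) (rho i) t) r
    (fun t => pairing a b (r^~ t) (rho^~ t)) oJ hJ hm (form_alpha hq) anc
    (form_r hq) r0 _ _ cQ Q1).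
  - move=> rz; apply: nc => i j _.
    apply: eq_constant_over (pairing_constant a b i j rz p0 rp).
    by move=> t Jt; rewrite (form_dot hq).
  - by move=> t i j; exact: pairing_sym.
  - move=> i t Jt; apply: cvgB; last exact: cv.
    have [_ D _] := C2_onP (form_alpha hq) Jt.
    by apply: cvgM; exact: (is_derive_continuous D).
  - move=> i t Jt; have [E _ _ _] := (pol t Jt).2 i.
    by rewrite mulrBl; move: E; move: (derive1n 2 _ t) => A; lra.
  - by move=> i t Jt; have [_ E _ _] := (pol t Jt).2 i; exact: E.
have [c2 c20 Hc2] : exists2 c, c != 0 & forall t, J t ->
    inertia m (rho^~ t) != 0 /\ derive1 beta t = c / inertia m (rho^~ t).
  apply: (@momentum_neq0 _ _ J m b beta
    (fun i t => derive1 beta t ^+ 2 - speed_sq alpha beta (r i) (rho i) t) rho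
    (fun t => pairing a b (r^~ t) (rho^~ t)) oJ hJ hm (form_beta hq) bnc
    (form_rho hq) p0 _ _ cQ Q1).
  - move=> pz; apply: nc => i j _.
    have pr k t : J t -> rho k t ^+ 2 + r k t ^+ 2 = 1.
      by move=> Jt; rewrite addrC rp.
    apply: eq_constant_over (pairing_constant b a i j pz r0 pr).
    by move=> t Jt; rewrite (form_dot hq) // pairing_swap.
  - by move=> t i j; exact: pairing_sym.
  - move=> i t Jt; apply: cvgB; last exact: cv.
    have [_ D _] := C2_onP (form_beta hq) Jt.
    by apply: cvgM; exact: (is_derive_continuous D).
  - move=> i t Jt; have [_ _ E _] := (pol t Jt).2 i.
    by rewrite mulrBl; move: E; move: (derive1n 2 _ t) => A; lra.
  - by move=> i t Jt; have [_ _ _ E] := (pol t Jt).2 i; exact: E.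
exists c1, c2; split.
- split => //; rewrite gt_eqF // /total_mass.
  by rewrite (bigD1 (Ordinal N0)) //= ltr_wpDr // sumr_ge0 // => ? _; exact: ltW.
- move=> t Jt I; have [I0 aE] := Hc1 t Jt; have := Hc2 t Jt.
  by rewrite inertia_rho // => -[MI bE]; split.
- exists (fun i => derive1 (r i)) => t Jt.
  split=> [i j ij|i].
    by rewrite (form_qr hq) //; exact: (pol t Jt).1.
  have [_ aE] := Hc1 t Jt; have [_] := Hc2 t Jt; rewrite inertia_rho // => bE.
  have [E1 E2 E3 E4] := (pol t Jt).2 i.
  have [Dr DDr _] := C2_onP (form_r hq i) Jt.
  have qE j := form_qr hq i j Jt.
  split.
  + exact: Dr.
  + by refine (is_derive_eq DDr _); apply/(radial_GP oJ hq i Jt aE bE).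
  + by rewrite E2; exact/esym/eq_tangential_force.
  + by rewrite E4; exact/esym/eq_tangential_force.
Qed.

(* Where [r i] is [1], the radial equation for [rho i] is a limit of its
   instances at times with [r i] below [1]. *)
Lemma pulsation_solution : G_densely_defined J r ->
  pulsation_equations J m a b alpha beta r rho -> solution J m q.
Proof.
move=> Gd [c1 [c2 [_ ang [s sys]]]]; apply/(solution_polarP oJ hq).
have sE i t : J t -> derive1 (r i) t = s i t.
  move=> Jt; have [_ /(_ i)[D _ _ _]] := sys t Jt.
  by rewrite derive1E; have [_ ->] := D.
have ne t i j : J t -> i != j -> pairing a b (r^~ t) (rho^~ t) i j ^+ 2 != 1.
  by move=> Jt ij; have [/(_ i j ij)] := sys t Jt; rewrite (form_qr hq).
have E1 i t : J t -> derive1n 2 (r i) t - r i t * derive1 alpha t ^+ 2 =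
    radial_force m (pairing a b (r^~ t) (rho^~ t)) a (r^~ t) i
    - speed_sq alpha beta (r i) (rho i) t * r i t.
  move=> Jt; have [_ _ aE bE] := ang t Jt.
  apply/(radial_GP oJ hq i Jt aE bE); rewrite sE //.
  have [_ /(_ i)[_ D _ _]] := sys t Jt.
  (* As [r i' = s i] on all of [J], the derivative of [s i] is the second derivative of [r i]. *)
  have [_ <-] := open_near_eq_is_derive oJ Jt (sE i) D.
  by rewrite -derive1E.
have E3 i t : J t -> derive1n 2 (rho i) t - rho i t * derive1 beta t ^+ 2 =
    radial_force m (pairing a b (r^~ t) (rho^~ t)) b (rho^~ t) i
    - speed_sq alpha beta (r i) (rho i) t * rho i t.
  move=> Jt.
  have cp k : {for t, continuous (rho k)}.
    by have [/is_derive_continuous] := C2_onP (form_rho hq k) Jt.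
  (* The passage to the limit uses that the second derivative of [rho i] is continuous. *)
  have [_ _ cddp] := C2_onP (form_rho hq i) Jt.
  have [_ /is_derive_continuous cdb _] := C2_onP (form_beta hq) Jt.
  have cdb2 : {for t, continuous (fun u => rho i u * derive1 beta u ^+ 2)}.
    by apply: cvgM; [exact: cp|apply: cvgM; exact: cdb].
  have cF : {for t, continuous (fun u =>
      radial_force m (pairing a b (r^~ u) (rho^~ u)) b (rho^~ u) i)}.
    apply: continuous_radial_force => // [j k|j k jk].
      exact: (form_continuous_pairing hq).
    by apply: (form_pairing_lt1 hq) => //; exact: ne.
  have cv : {for t, continuous (fun u =>
      speed_sq alpha beta (r i) (rho i) u * rho i u)}.
    by apply: cvgM; [exact: (form_continuous_speed_sq hq)|exact: cp].
  apply: (@continuous_eq_closure _ _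
    (fun u => derive1n 2 (rho i) u - rho i u * derive1 beta u ^+ 2)
    (fun u => radial_force m (pairing a b (r^~ u) (rho^~ u)) b (rho^~ u) i
      - speed_sq alpha beta (r i) (rho i) u * rho i u) t _ _ _ (Gd i t Jt)).
  - exact: cvgB cddp cdb2.
  - exact: cvgB cF cv.
  move=> u [Ju ri1].
  apply: (radial_rho_of_r oJ hq Ju); last exact: E1.
  apply/eqP => p0; have [_ _] := form_bounds hq i Ju.
  rewrite p0 expr0n addr0 => /eqP; rewrite sqrp_eq1.
    by rewrite (lt_eqF ri1).
  by have [/andP[]] := form_bounds hq i Ju.
move=> t Jt; split=> [i j|i]; first exact: ne.
have [_ /(_ i)[_ _ E2 E4]] := sys t Jt.
have qE j := form_qr hq i j Jt.
split.
- exact: E1.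
- by rewrite E2; exact: eq_tangential_force.
- exact: E3.
- by rewrite E4; exact: eq_tangential_force.
Qed.

Lemma form_dot_qr i j t : J t -> dot (q i t) (q j t) = qr a b (r^~ t) i j.
Proof. by move=> Jt; rewrite (form_dot hq) // (form_qr hq). Qed.

Lemma constant_dot_qr i j :
  constant_over J (fun t => dot (q i t) (q j t)) <->
  constant_over J (fun t => qr a b (r^~ t) i j).
Proof.
by split; apply: eq_constant_over => t Jt; rewrite form_dot_qr.
Qed.

End equivalence.

Theorem mainTheorem4 (R : realType) (N : nat) (hN : (2 <= N)%N)
    (J : set R) (hJo : open J) (hJi : is_interval J)
    (m : 'I_N -> R) (hm : forall i, 0 < m i)
    (q : 'I_N -> R -> 'rV[R]_4) (a b : 'I_N -> R) (alpha beta : R -> R)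
    (r rho : 'I_N -> R -> R)
    (hq : elliptic_elliptic_form J q a b alpha beta r rho) :
  [/\ (rotopulsator J m q ->
         pulsation_equations J m a b alpha beta r rho /\
         exists i j, i != j /\
           ~ constant_over J (fun t => qr a b (r^~ t) i j)),
      (G_densely_defined J r ->
         pulsation_equations J m a b alpha beta r rho /\
         (exists i j, i != j /\
           ~ constant_over J (fun t => qr a b (r^~ t) i j)) ->
         rotopulsator J m q),
      (G_densely_defined J r ->
         pulsation_equations J m a b alpha beta r rho ->
         (forall i j, i != j ->
           constant_over J (fun t => qr a b (r^~ t) i j)) ->
         relative_equilibrium J m q)
    & (forall i j t, i != j -> J t ->
         dot (q i t) (q j t) = 1 \/ dot (q i t) (q j t) = -1 ->
         ~ rotopulsator J m q /\ ~ relative_equilibrium J m q)].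
Proof.
have form : positive_elliptic_elliptic J q by exists a, b, alpha, beta, r, rho.
split.
- move=> [sol _ [i [j [ij nc]]]]; split.
    apply: (solution_pulsation hJo hJi hm hq (ltnW hN) sol) => cst.
    exact/nc/cst.
  by exists i, j; split => // /(constant_dot_qr hq).
- move=> Gd [puls [i [j [ij nc]]]]; split => //.
    exact: (pulsation_solution hJo hq Gd puls).
  by exists i, j; split => // /(constant_dot_qr hq).
- move=> Gd puls cst; split => //.
    exact: (pulsation_solution hJo hq Gd puls).
  by move=> i j ij; apply/(constant_dot_qr hq)/cst.
- move=> i j t ij Jt dot1.
  (* A solution has [q_ij ^ 2 != 1] at every time in [J], and both kinds of motion are solutions. *)
  have nsol : ~ solution J m q.
    move=> /(_ t Jt)[/(_ i j ij) /eqP + _]; apply.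
    by case: dot1 => ->; rewrite ?sqrrN expr1n.
  by split=> -[/nsol].
Qed.
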